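(* Let $G$ be a finite noncyclic nilpotent group without any generalized quaternion Sylow subgroup, and suppose that $\mathcal{G}_E^{**}(G)$ is connected. Then $\mathrm{diam}(\mathcal{G}_E^{**}(G))=3$.
   Context: For a group $G$, the enhanced power graph $\mathcal{G}_E(G)$ is the simple graph with vertex set $G$ in which two distinct elements $x,y$ are adjacent if and only if there is $w\in G$ with $x,y\in\langle w\rangle$. A dominating vertex of a graph is a vertex adjacent to every other vertex. The proper enhanced power graph $\mathcal{G}_E^{**}(G)$ is the induced subgraph of $\mathcal{G}_E(G)$ obtained by deleting all dominating vertices of $\mathcal{G}_E(G)$. The diameter $\mathrm{diam}(\Gamma)$ of a connected graph is the maximum over pairs of vertices of the length of a shortest path between them. *)

(* Defs.v *)
From mathcomp Require Import all_boot all_fingroup all_solvable.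

Set Implicit Arguments.
Unset Strict Implicit.
Unset Printing Implicit Defensive.

Local Open Scope group_scope.

(* A finite simple graph whose vertex set is a subset of a finite type T. *)
Record sgraph (T : finType) := SGraph {
  vertices : {set T};
  adj : rel T;
  adj_vertices : forall x y, adj x y -> (x \in vertices) && (y \in vertices);
  adj_sym : symmetric adj;
  adj_irrefl : irreflexive adj
}.

Section SimpleGraphs.
Variables (T : finType) (Gamma : sgraph T).

Definition dominating (x : T) : bool :=
  (x \in vertices Gamma) &&
  [forall (y | (y \in vertices Gamma) && (y != x)), adj Gamma x y].

Definition induced_adj (A : {set T}) : rel T :=
  fun x y => [&& x \in A, y \in A & adj Gamma x y].

Lemma induced_adj_vertices A x y : induced_adj A x y ->
  (x \in vertices Gamma :&: A) && (y \in vertices Gamma :&: A).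
Proof.
by rewrite !inE => /and3P[-> -> /adj_vertices/andP[-> ->]].
Qed.

Lemma induced_adj_sym A : symmetric (induced_adj A).
Proof.
by move=> x y; rewrite /induced_adj adj_sym andbA (andbC (x \in A)) -andbA.
Qed.

Lemma induced_adj_irrefl A : irreflexive (induced_adj A).
Proof. by move=> x; rewrite /induced_adj adj_irrefl !andbF. Qed.

Definition induced (A : {set T}) : sgraph T :=
  SGraph (@induced_adj_vertices A) (@induced_adj_sym A) (@induced_adj_irrefl A).

Definition connected : Prop :=
  forall x y, x \in vertices Gamma -> y \in vertices Gamma ->
  connect (adj Gamma) x y.

Definition walk (k : nat) (x y : T) : bool :=
  [exists p : k.-tuple T, path (adj Gamma) x p && (last x p == y)].

(* The length of a shortest path from x to y. A shortest path has fewer than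
   #|T| edges, so it is enough to search below #|T|; the default value #|T|
   is only reached for x and y in distinct components (see dist_walk). *)
Definition dist (x y : T) : nat :=
  \big[minn/#|T|]_(k < #|T| | walk k x y) k.

Definition diam : nat :=
  \max_(x in vertices Gamma) \max_(y in vertices Gamma) dist x y.

Lemma walkP k x y :
  reflect (exists p, [/\ path (adj Gamma) x p, last x p = y & size p = k])
          (walk k x y).
Proof.
apply: (iffP existsP) => [[p /andP[xp /eqP yp]] | [p [xp yp /eqP sz_p]]].
  by exists p; rewrite size_tuple.
by exists (Tuple sz_p); rewrite xp yp eqxx.
Qed.

Lemma dist_leq k x y : walk k x y -> dist x y <= k.
Proof.
case/walkP=> p [xp yp sz_p]; case: (shortenP xp) (yp) => q xq Uq sub_qp yq.
have lt_q: size q < #|T|.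
  by have /card_uniqP/= <- := Uq; apply: max_card.
have le_qk: size q <= k.
  by rewrite -sz_p uniq_leq_size //; case/andP: Uq.
apply: leq_trans le_qk.
have wq: walk (size q) x y by apply/walkP; exists q.
rewrite /dist; have: Ordinal lt_q \in index_enum 'I_#|T| by exact: mem_index_enum.
elim: index_enum => //= i r IHr; rewrite inE big_cons => /predU1P[<-|/IHr le_r].
  by rewrite /= wq geq_minl.
by case: ifP => // _; apply: leq_trans (geq_minr _ _) le_r.
Qed.

Lemma dist_walk x y : connect (adj Gamma) x y -> walk (dist x y) x y.
Proof.
move=> /connectP[p xp yp].
have wp: walk (size p) x y by apply/walkP; exists p.
have [//|lt_d] : walk (dist x y) x y \/ dist x y = #|T|.
  rewrite /dist; apply: (big_ind (fun d => walk d x y \/ d = #|T|)).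
  - by right.
  - by move=> d e; rewrite /minn; case: ifP.
  - by move=> k; left.
case: (shortenP xp) yp => q xq Uq _ yq.
have /dist_leq: walk (size q) x y by apply/walkP; exists q.
by have /card_uniqP/= := Uq; rewrite lt_d => sz_q; rewrite leqNgt -sz_q max_card.
Qed.

End SimpleGraphs.

Section EnhancedPowerGraph.
Variables (gT : finGroupType) (G : {group gT}).

Definition epg_adj : rel gT := fun x y =>
  [&& x \in G, y \in G, x != y &
      [exists w in G, (x \in <[w]>) && (y \in <[w]>)]].

Lemma epg_adj_vertices x y : epg_adj x y -> (x \in G) && (y \in G).
Proof. by case/and4P=> -> ->. Qed.

Lemma epg_adj_sym : symmetric epg_adj.
Proof.
move=> x y; rewrite /epg_adj andbCA eq_sym; do 3!congr (_ && _).
by apply: eq_existsb => w; rewrite (andbC (x \in _)).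
Qed.

Lemma epg_adj_irrefl : irreflexive epg_adj.
Proof. by move=> x; rewrite /epg_adj eqxx !andbF. Qed.

Definition enhanced_power_graph : sgraph gT :=
  SGraph epg_adj_vertices epg_adj_sym epg_adj_irrefl.

Definition proper_enhanced_power_graph : sgraph gT :=
  induced enhanced_power_graph [set x | ~~ dominating enhanced_power_graph x].

Definition generalized_quaternion : Prop :=
  exists2 n, n > 2 & G \isog 'Q_(2 ^ n).

End EnhancedPowerGraph.

(* Main.v *)
Require Import Defs.
From mathcomp Require Import all_boot all_fingroup all_solvable.

(** Everything rests on one fact about cyclic groups: they have at most one
    subgroup of each prime order. So if u and v lie in a common cyclic subgroup
    and p divides the orders of both, then u and v have the same subgroup of
    order p among their powers ([joined_prime_order]).

    A p-group with a single subgroup of order p is cyclic or generalized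
    quaternion, so in G each noncyclic Sylow p-subgroup contains a and b of
    order p generating different subgroups ([exists_independent_pair]); no
    cyclic subgroup contains both. Let N be the set of primes p whose Sylow
    subgroup is noncyclic. An element of order divisible by some p in N cannot
    dominate, since a or b escapes it. Conversely the Hall subgroup at the
    primes outside N is cyclic and G is nilpotent, so every element of that
    subgroup dominates. The remaining vertices are thus exactly the elements
    whose order is divisible by some p in N ([proper_vertexP]).

    If N were empty, that cyclic Hall subgroup would be G, which is noncyclic.
    If N were a single prime p, all vertices would have order divisible by p,
    adjacent vertices would share their subgroup of order p, and a and b would
    lie in distinct components. So N has at least two elements.

    For the upper bound, note that in a nilpotent group elements of coprime
    orders lie in a common cyclic subgroup. If p divides the order of x and q
    that of y, with p and q distinct in N, then x - a - b - y is a walk, where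
    a and b are powers of x and y of orders p and q. Otherwise some q in N
    divides neither order, and any element of order q is a common neighbour.

    For the lower bound, take x having among its powers an a_p of order p for
    every p in N at once, and y likewise with b_p, where a_p and b_p generate
    different subgroups ([exists_far_vertices]). The order of a common
    neighbour z is divisible by some p in N; then a_p and b_p are both powers
    of z, which is impossible. *)

Set Implicit Arguments.
Unset Strict Implicit.

Local Open Scope group_scope.

(** * Distances and the diameter of a simple graph *)

(** Allowing repeated vertices spares a case analysis on coincidences when a
    short walk is exhibited between vertices that need not be distinct. *)
Lemma dist_lazy_path (T : finType) (Gamma : sgraph T) (p : seq T) (x : T) :
  path [rel u v | (u == v) || adj Gamma u v] x p ->
  dist Gamma x (last x p) <= size p.
Proof.
move=> xp; suff [q [xq eq_last le_qp]] : exists q,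
    [/\ path (adj Gamma) x q, last x q = last x p & size q <= size p].
  by apply: leq_trans le_qp; apply: dist_leq; apply/walkP; exists q.
elim: p x xp => [|y p IHp] x /=; first by exists [::].
case/andP=> xy /IHp[q [yq eq_last le_qp]].
case/predU1P: xy => [->|xy]; last by exists (y :: q); rewrite /= xy.
by exists q; split=> //; apply: leqW.
Qed.

Lemma dist_gt2 (T : finType) (Gamma : sgraph T) (x y : T) :
  connect (adj Gamma) x y ->
  (forall z, (x == z) || adj Gamma x z -> (z == y) || adj Gamma z y -> False) ->
  2 < dist Gamma x y.
Proof.
move=> /dist_walk/walkP[p [xp yp <-]] far; rewrite ltnNge; apply/negP.
case: p xp yp => [|z [|t [|? ?]]] //= => [_ eq_xy _ | /andP[xz _] eq_zy _ | ].
- by apply: (far x); rewrite ?eq_xy eqxx.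
- by apply: (far z); rewrite ?xz ?eq_zy ?eqxx ?orbT.
- by case/and3P=> xz zt _ eq_ty _; apply: (far z); rewrite ?xz -?eq_ty ?zt orbT.
Qed.

Lemma diam_eq (T : finType) (Gamma : sgraph T) (d : nat) (x y : T) :
  (forall u v, u \in vertices Gamma -> v \in vertices Gamma ->
     dist Gamma u v <= d) ->
  x \in vertices Gamma -> y \in vertices Gamma -> d <= dist Gamma x y ->
  diam Gamma = d.
Proof.
move=> le_d Vx Vy d_le; apply/eqP; rewrite eqn_leq; apply/andP; split.
  by apply/bigmax_leqP=> u Vu; apply/bigmax_leqP=> v; apply: le_d.
by apply: leq_trans d_le _; apply: (bigmax_sup x) => //; apply: (bigmax_sup y).
Qed.

(** * Elements with a common cyclic overgroup *)

(** Adjacency in the enhanced power graph without the condition that the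
    elements be distinct; reflexivity on G makes it the convenient relation. *)
Definition joined (gT : finGroupType) (G : {group gT}) : rel gT :=
  fun x y => [exists w in G, (x \in <[w]>) && (y \in <[w]>)].

Lemma joinedP (gT : finGroupType) (G : {group gT}) (x y : gT) :
  reflect (exists w, [/\ w \in G, x \in <[w]> & y \in <[w]>]) (joined G x y).
Proof.
apply: (iffP exists_inP) => [[w Gw /andP[xw yw]] | [w [Gw xw yw]]].
  by exists w.
by exists w; rewrite ?xw.
Qed.

Lemma joined_sym (gT : finGroupType) (G : {group gT}) : symmetric (joined G).
Proof. by move=> x y; apply: eq_existsb => w; rewrite (andbC (x \in _)). Qed.

Lemma mem_cycle_joined (gT : finGroupType) (G : {group gT}) (x y : gT) :
  x \in G -> y \in <[x]> -> joined G x y.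
Proof. by move=> Gx xy; apply/joinedP; exists x; rewrite cycle_id. Qed.

(** A cyclic group containing u and v has a single subgroup of order #[z],
    which must then be both <[z]> and the one that Cauchy provides in <[v]>. *)
Lemma joined_prime_order (gT : finGroupType) (G : {group gT}) (u v z : gT) :
  joined G u v -> z \in <[u]> -> prime #[z] -> #[z] %| #[v] -> z \in <[v]>.
Proof.
case/joinedP=> w [_ uw vw] zu pr_z /(Cauchy pr_z)[t vt oz_t].
have sub_w s a : s \in <[w]> -> a \in <[s]> -> <[a]> \subset <[w]>.
  by move=> sw as_; rewrite cycle_subG (subsetP _ _ as_) // cycle_subG.
have eq_zt: <[z]> == <[t]>.
  rewrite (eq_subG_cyclic (cycle_cyclic w)) ?(sub_w u z) ?(sub_w v t) //.
  by apply/eqP; rewrite -[LHS]/(#[z]) -oz_t.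
by rewrite -cycle_subG (eqP eq_zt) cycle_subG.
Qed.

Lemma nilpotent_commute (gT : finGroupType) (G : {group gT}) (x y : gT) :
  nilpotent G -> x \in G -> y \in G -> coprime #[x] #[y] -> commute x y.
Proof.
move=> nilG Gx Gy co_xy.
have sGy: <[y]> \subset G by rewrite cycle_subG.
have sGx: <[x]> \subset G by rewrite cycle_subG.
have := sub_nilpotent_cent2 nilG sGx sGy co_xy.
by rewrite cent_cycle cycle_subG => /cent1P.
Qed.

Lemma nilpotent_cycleM (gT : finGroupType) (G : {group gT}) (x y : gT) :
  nilpotent G -> x \in G -> y \in G -> coprime #[x] #[y] ->
  <[x * y]> = <[x]> * <[y]>.
Proof.
by move=> nilG Gx Gy co_xy; apply: cycleM => //; apply: (@nilpotent_commute _ G).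
Qed.

Lemma coprime_joined (gT : finGroupType) (G : {group gT}) (x y : gT) :
  nilpotent G -> x \in G -> y \in G -> coprime #[x] #[y] -> joined G x y.
Proof.
move=> nilG Gx Gy co_xy; apply/joinedP; exists (x * y); rewrite groupM //.
rewrite (@nilpotent_cycleM _ G) //; split=> //.
  by apply: (subsetP (mulG_subl _ _)); apply: cycle_id.
by apply: (subsetP (mulG_subr _ _)); apply: cycle_id.
Qed.

(** Elements of a nilpotent group of pairwise coprime orders commute, and each
    is a power of their product, which is the x below. The induction also keeps
    track of the primes that occur in the order of the product. *)
Lemma nilpotent_cycle_of_pelts (gT : finGroupType) (G : {group gT})
    (s : seq nat) (f : nat -> gT) :
  nilpotent G -> uniq s -> {in s, forall p, f p \in G /\ p.-elt (f p)} ->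
  exists2 x, x \in G & {in s, forall p, f p \in <[x]>}.
Proof.
move=> nilG Us Gf.
suff [x [Gx s_x fx]] : exists x, [/\ x \in G, [pred p in s].-elt x &
    {in s, forall p, f p \in <[x]>}] by exists x.
elim: s Us Gf => [|p s IHs] /=; first by exists 1; rewrite group1 p_elt1.
case/andP=> s'p Us Gf; have [Gfp p_fp] := Gf p (mem_head p s).
have [|x [Gx s_x fx]] := IHs Us; first by move=> q sq; apply: Gf; apply: mem_behead.
have co_fx: coprime #[f p] #[x].
  apply: pnat_coprime p_fp _; apply: sub_in_pnat s_x => q _ sq.
  by apply: contraNneq s'p => <-.
exists (f p * x); rewrite groupM //; split=> //.
  rewrite /p_elt orderM //; last exact: (@nilpotent_commute _ G).
  rewrite pnatM; apply/andP; split.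
    by apply: sub_in_pnat p_fp => q _ /eqnP->; apply: mem_head.
  by apply: sub_in_pnat s_x => q _ sq; apply: mem_behead.
move=> q; rewrite (@nilpotent_cycleM _ G) // => /predU1P[->|/fx].
  by apply: (subsetP (mulG_subl _ _)); apply: cycle_id.
by apply: subsetP; apply: mulG_subr.
Qed.

(** * Primes with a noncyclic Sylow subgroup *)

(** In a nilpotent group 'O_p(G) is the Sylow p-subgroup. *)
Definition noncyclic_primes (gT : finGroupType) (G : {group gT}) : nat_pred :=
  [pred p : nat | ~~ cyclic 'O_p(G)].

Definition independent_pair (gT : finGroupType) (G : {group gT}) (p : nat) :=
  [pred ab : gT * gT | [&& ab.1 \in G, ab.2 \in G, #[ab.1] == p, #[ab.2] == p
                         & ab.2 \notin <[ab.1]>]].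

Definition has_independent_pairs (gT : finGroupType) (G : {group gT}) : Prop :=
  forall p, p \in noncyclic_primes G -> exists ab, ab \in independent_pair G p.

Lemma noncyclic_primesP (gT : finGroupType) (G : {group gT}) (p : nat) :
  p \in noncyclic_primes G -> prime p /\ p %| #|G|.
Proof.
rewrite inE => ncP.
have ntP: 'O_p(G) != 1 by apply: contraNneq ncP => ->; apply: cyclic1.
have [pr_p p_dv _] := pgroup_pdiv (pcore_pgroup p G) ntP.
by split=> //; apply: dvdn_trans p_dv (cardSg (pcore_sub p G)).
Qed.

(** If every b of order p were a power of a fixed a of order p, then 'Ohm_1 of
    the Sylow subgroup would be <[a]>, of order p, which forces the Sylow
    subgroup to be cyclic or generalized quaternion. *)
Lemma exists_independent_pair (gT : finGroupType) (G : {group gT}) (p : nat) :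
  p \in noncyclic_primes G -> ~ generalized_quaternion 'O_p(G)%G ->
  exists ab, ab \in independent_pair G p.
Proof.
move=> ncp notQ; have [pr_p _] := noncyclic_primesP ncp; rewrite inE in ncp.
have pP := pcore_pgroup p G; have sPG := pcore_sub p G.
have ntP: 'O_p(G) != 1 by apply: contraNneq ncp => ->; apply: cyclic1.
have [_ p_dv _] := pgroup_pdiv pP ntP.
have [a Pa oa] := Cauchy pr_p p_dv.
have: ~~ ('Ohm_1('O_p(G)) \subset <[a]>).
  apply/negP=> sOa; case/negP: (ncp).
  have: #|'Ohm_1('O_p(G))| = p.
    have Oa: a \in 'Ohm_1('O_p(G)).
      by rewrite (OhmE 1 pP) mem_gen // !inE Pa -order_dvdn oa dvdnn.
    have := cardSg sOa; rewrite -orderE oa => Op_p.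
    apply/eqP; rewrite eqn_dvd Op_p /=.
    by rewrite -[X in X %| _]oa; apply: order_dvdG.
  move/(prime_Ohm1P pP ntP)=> /orP[//|/andP[_ /eqP/quaternion_classP Q]].
  by case: notQ.
rewrite (OhmE 1 pP) gen_subG => /subsetPn[b]; rewrite !inE => /andP[Pb bp1] nab.
exists (a, b); rewrite !inE /= (subsetP sPG) // (subsetP sPG) // oa eqxx nab.
have /primeP[_ dv_p] := pr_p; have /dv_p/orP[|->//] : #[b] %| p by rewrite order_dvdn.
by rewrite order_eq1 => /eqP b1; rewrite b1 group1 in nab.
Qed.

Lemma independent_pair_no_cycle (gT : finGroupType) (G : {group gT}) (p : nat)
    (ab : gT * gT) (x : gT) :
  prime p -> ab \in independent_pair G p -> x \in G ->
  ab.1 \in <[x]> -> ab.2 \in <[x]> -> False.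
Proof.
move=> pr_p; rewrite inE => /and5P[Ga Gb /eqP oa /eqP ob /negP nab] Gx ax bx.
apply: nab; apply: (@joined_prime_order _ G ab.2); rewrite ?oa ?ob ?cycle_id //.
by apply/joinedP; exists x.
Qed.

(** All Sylow subgroups of this Hall subgroup are cyclic, and a nilpotent group
    with cyclic Sylow subgroups is cyclic. *)
Lemma nilpotent_cyclic_Hall (gT : finGroupType) (G : {group gT}) :
  nilpotent G -> cyclic 'O_(noncyclic_primes G)^'(G).
Proof.
move=> nilG; have sHG := pcore_sub (noncyclic_primes G)^' G.
apply: nil_Zgroup_cyclic; last exact: nilpotentS nilG.
apply/forall_inP=> V /SylowP[p pr_p sylV].
have sVH := pHall_sub sylV; have pV := pHall_pgroup sylV.
have [p_cyc | p_ncyc] := boolP (p \in (noncyclic_primes G)^').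
  apply: (cyclicS _ (negbNE p_cyc)).
  by rewrite (sub_Hall_pcore (nilpotent_pcore_Hall p nilG)) ?(subset_trans sVH).
suff ->: V :=: 1 by apply: cyclic1.
apply: card1_trivg; apply: (pnat_1 pV).
apply: sub_in_pnat (pgroupS sVH (pcore_pgroup _ G)) => q _ nq.
by apply: contraNneq p_ncyc => <-.
Qed.

(** These are the dominating elements. Write pi for the primes with a cyclic
    Sylow subgroup and h for a generator of the Hall pi-subgroup: x and the
    pi-part of y are powers of h, and h times the pi'-part of y generates a
    subgroup containing x and y. *)
Lemma noncyclic_primes'_elt_joined (gT : finGroupType) (G : {group gT}) (x y : gT) :
  nilpotent G -> x \in G -> y \in G -> (noncyclic_primes G)^'.-elt x ->
  joined G x y.
Proof.
move=> nilG Gx Gy x_cyc; set pi := (noncyclic_primes G)^' in x_cyc *.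
have [h defH] := cyclicP (nilpotent_cyclic_Hall nilG); rewrite -/pi in defH.
have hallH := nilpotent_pcore_Hall pi nilG.
have in_h z : z \in G -> pi.-elt z -> z \in <[h]>.
  by move=> Gz pi_z; rewrite -defH (mem_normal_Hall hallH) // pcore_normal.
have Gh: h \in G by rewrite (subsetP (pcore_sub pi G)) // defH cycle_id.
have Gy' : y.`_pi^' \in G by rewrite groupX.
have co_h: coprime #[h] #[y.`_pi^'].
  apply: (pnat_coprime _ (p_elt_constt _ _)).
  by have := pcore_pgroup pi G; rewrite defH.
apply/joinedP; exists (h * y.`_pi^'); rewrite groupM //.
rewrite (@nilpotent_cycleM _ G) //; split=> //.
  by rewrite (subsetP (mulG_subl _ _)) ?in_h.
by rewrite -{1}(consttC pi y) mem_mulg ?cycle_id ?in_h ?p_elt_constt ?groupX.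
Qed.

(** * Vertices and edges of the proper enhanced power graph *)

Lemma dominating_enhanced_power_graph (gT : finGroupType) (G : {group gT}) (x : gT) :
  dominating (enhanced_power_graph G) x =
    (x \in G) && [forall y in G, joined G x y].
Proof.
rewrite /dominating /=; case Gx: (x \in G) => //=.
apply: eq_forallb => y; rewrite /epg_adj Gx /= -/(joined G x y).
case Gy: (y \in G) => //=; rewrite eq_sym; case: eqVneq => //= <-.
by rewrite mem_cycle_joined ?cycle_id.
Qed.

(** If x were dominating with p dividing its order, it would be joined to both
    members of an independent pair at p, and so have both as powers. *)
Lemma proper_vertexP (gT : finGroupType) (G : {group gT}) (x : gT) :
  nilpotent G ->
  has_independent_pairs G ->
  reflect (x \in G /\ exists2 p, p \in noncyclic_primes G & p %| #[x])
          (x \in vertices (proper_enhanced_power_graph G)).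
Proof.
move=> nilG indG; rewrite !inE dominating_enhanced_power_graph.
apply: (iffP andP) => [[Gx] | [Gx [p ncp p_x]]].
  rewrite Gx /= => not_dom; split=> //.
  have: ~~ (noncyclic_primes G)^'.-elt x.
    apply: contra not_dom => x_cyc; apply/forall_inP=> y Gy.
    exact: noncyclic_primes'_elt_joined.
  rewrite /p_elt /pnat order_gt0 => /allPn[p]; rewrite mem_primes => /and3P[_ _ p_x].
  by rewrite /= negbK; exists p.
split=> //; rewrite Gx /=; apply/forall_inP=> dom_x.
have [pr_p _] := noncyclic_primesP ncp; have [ab indab] := indG p ncp.
have := indab; rewrite inE => /and5P[Ga Gb /eqP oa /eqP ob _].
have in_x z : z \in G -> #[z] = p -> z \in <[x]>.
  move=> Gz oz; apply: (@joined_prime_order _ G z); rewrite ?oz ?cycle_id //.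
  by rewrite joined_sym dom_x.
exact: (independent_pair_no_cycle pr_p indab Gx (in_x _ Ga oa) (in_x _ Gb ob)).
Qed.

Lemma prime_order_proper_vertex (gT : finGroupType) (G : {group gT}) (p : nat) (z : gT) :
  nilpotent G -> has_independent_pairs G -> p \in noncyclic_primes G ->
  z \in G -> #[z] = p -> z \in vertices (proper_enhanced_power_graph G).
Proof.
move=> nilG indG ncp Gz oz; apply/proper_vertexP=> //; split=> //.
by exists p; rewrite ?oz.
Qed.

Lemma proper_adj (gT : finGroupType) (G : {group gT}) (x y : gT) :
  adj (proper_enhanced_power_graph G) x y =
    [&& x \in vertices (proper_enhanced_power_graph G),
        y \in vertices (proper_enhanced_power_graph G), x != y & joined G x y].
Proof.
rewrite /= /induced_adj /= /epg_adj -/(joined G x y) !inE.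
by do ![case: (_ \in G); rewrite ?andbF //=].
Qed.

(** * The diameter *)

(** If p were the only such prime, it would divide the order of every vertex,
    so that an element of order p which is a power of some vertex would be a
    power of every vertex of its connected component; but neither member of an
    independent pair is a power of the other. *)
Lemma connected_noncyclic_primes (gT : finGroupType) (G : {group gT}) (p : nat) :
  nilpotent G ->
  has_independent_pairs G ->
  connected (proper_enhanced_power_graph G) -> p \in noncyclic_primes G ->
  exists2 q, q \in noncyclic_primes G & q != p.
Proof.
move=> nilG indG conn ncp; have [pr_p _] := noncyclic_primesP ncp.
have [ab indab] := indG p ncp; have := indab.
rewrite inE => /and5P[Ga Gb /eqP oa /eqP ob /negP nab].
have Vp := prime_order_proper_vertex nilG indG ncp.
have /connectP[s] := conn ab.2 ab.1 (Vp _ Gb ob) (Vp _ Ga oa).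
(* Primes dividing #|G| are bounded, which makes the case distinction decidable. *)
have [q /andP[ncq q'p] | only_p] :=
  pickP [pred q : 'I_#|G|.+1 | (val q \in noncyclic_primes G) && (val q != p)].
  by exists q.
suff invar: forall u, ab.2 \in <[u]> -> path (adj (proper_enhanced_power_graph G)) u s ->
    ab.2 \in <[last u s]>.
  by move=> /invar-/(_ (cycle_id _)) + eq_last; rewrite -eq_last => /nab.
elim: s => //= v s IHs u bu /andP[uv vs]; apply: IHs vs.
have := uv; rewrite -[induced_adj _ _ _ _]/(adj (proper_enhanced_power_graph G) u v).
rewrite proper_adj => /and4P[_ Vv _ join_uv].
apply: joined_prime_order join_uv bu _ _; rewrite ob //.
have [_ [q ncq q_v]] := proper_vertexP _ nilG indG Vv.
have [pr_q q_G] := noncyclic_primesP ncq.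
have lt_q: q < #|G|.+1 by rewrite ltnS dvdn_leq.
by have := only_p (Ordinal lt_q); rewrite /= ncq /= => /negbFE/eqP<-.
Qed.

Lemma proper_dist_le3 (gT : finGroupType) (G : {group gT}) (x y : gT) :
  nilpotent G ->
  has_independent_pairs G ->
  connected (proper_enhanced_power_graph G) ->
  x \in vertices (proper_enhanced_power_graph G) ->
  y \in vertices (proper_enhanced_power_graph G) ->
  dist (proper_enhanced_power_graph G) x y <= 3.
Proof.
move=> nilG indG conn Vx Vy; set Gamma := proper_enhanced_power_graph G in Vx Vy *.
have lazy u v : u \in vertices Gamma -> v \in vertices Gamma -> joined G u v ->
    (u == v) || adj Gamma u v.
  by move=> Vu Vv uv; rewrite proper_adj Vu Vv uv andbT orbN.
have Vprime := prime_order_proper_vertex nilG indG.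
have [Gx [p ncp p_x]] := proper_vertexP _ nilG indG Vx.
have [Gy [q ncq q_y]] := proper_vertexP _ nilG indG Vy.
have far p1 q1 : p1 \in noncyclic_primes G -> q1 \in noncyclic_primes G ->
    q1 != p1 -> p1 %| #[x] -> q1 %| #[y] -> dist Gamma x y <= 3.
  move=> ncp1 ncq1 ne_pq p1_x q1_y.
  have [[pr_p _] [pr_q _]] := (noncyclic_primesP ncp1, noncyclic_primesP ncq1).
  have [a ax oa] := Cauchy pr_p p1_x; have [b yb ob] := Cauchy pr_q q1_y.
  have Ga: a \in G by apply: subsetP ax; rewrite cycle_subG.
  have Gb: b \in G by apply: subsetP yb; rewrite cycle_subG.
  have Va := Vprime _ _ ncp1 Ga oa; have Vb := Vprime _ _ ncq1 Gb ob.
  apply: (@dist_lazy_path _ Gamma [:: a; b; y] x); rewrite [path _ _ _]/= andbT.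
  have join_ab: joined G a b.
    by apply: coprime_joined; rewrite // oa ob prime_coprime // dvdn_prime2 // eq_sym.
  by rewrite !lazy //; rewrite ?[joined G b y]joined_sym; apply: mem_cycle_joined.
have [eq_qp | ne_qp] := eqVneq q p; last exact: far ne_qp p_x q_y.
(* Here p divides both orders; a second prime r either divides one of them, which
   gives a walk of length 3, or yields a common neighbour of order r. *)
have [r ncr ne_rp] := connected_noncyclic_primes nilG indG conn ncp.
have [pr_r r_G] := noncyclic_primesP ncr.
have [r_y | r'y] := boolP (r %| #[y]); first exact: far ne_rp p_x r_y.
have [r_x | r'x] := boolP (r %| #[x]).
  by apply: far ncr ncp _ r_x _; rewrite -?eq_qp // eq_sym eq_qp.
have [z Gz oz] := Cauchy pr_r r_G.
have join_z t : t \in G -> ~~ (r %| #[t]) -> joined G z t.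
  by move=> Gt r't; apply: coprime_joined; rewrite // oz prime_coprime.
have Vz := Vprime _ _ ncr Gz oz.
apply: leqW; apply: (@dist_lazy_path _ Gamma [:: z; y] x).
by rewrite [path _ _ _]/= andbT !lazy ?join_z // joined_sym join_z.
Qed.

(** Collecting one member of an independent pair at every prime at once is what
    makes the two vertices far apart: whichever prime divides the order of a
    third vertex, it then separates x from y there. *)
Lemma exists_far_vertices (gT : finGroupType) (G : {group gT}) :
  nilpotent G ->
  has_independent_pairs G ->
  exists x y, [/\ x \in G, y \in G &
    forall p, p \in noncyclic_primes G ->
      exists2 ab, ab \in independent_pair G p & ab.1 \in <[x]> /\ ab.2 \in <[y]>].
Proof.
move=> nilG indG; pose f p := odflt (1, 1) [pick ab in independent_pair G p].
have fP p : p \in noncyclic_primes G -> f p \in independent_pair G p.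
  by rewrite /f => /indG[ab indab]; case: pickP => // /(_ ab)/=; rewrite indab.
pose s := [seq p <- primes #|G| | p \in noncyclic_primes G].
have Us: uniq s by rewrite filter_uniq ?primes_uniq.
have mem_s p : p \in s = (p \in noncyclic_primes G).
  rewrite mem_filter; apply/andb_idr=> /noncyclic_primesP[pr_p p_G].
  by rewrite mem_primes pr_p cardG_gt0.
have elt_p p z : p \in noncyclic_primes G -> #[z] == p -> p.-elt z.
  by move=> /noncyclic_primesP[pr_p _] /eqP oz; rewrite /p_elt oz pnat_id.
have [|x Gx fx] := @nilpotent_cycle_of_pelts _ G s (fun p => (f p).1) nilG Us.
  by move=> p; rewrite mem_s => ncp; have /and5P[? _ /elt_p-> ] := fP p ncp.
have [|y Gy fy] := @nilpotent_cycle_of_pelts _ G s (fun p => (f p).2) nilG Us.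
  by move=> p; rewrite mem_s => ncp; have /and5P[_ ? _ /elt_p-> ] := fP p ncp.
exists x, y; split=> // p ncp; exists (f p); first exact: fP.
by rewrite fx ?fy ?mem_s.
Qed.

Unset Implicit Arguments.

Theorem theorem5p9 (gT : finGroupType) (G : {group gT})
    (G_noncyclic : ~~ cyclic G) (G_nilpotent : nilpotent G)
    (no_quaternion_Sylow : forall (p : nat) (P : {group gT}),
       prime p -> p.-Sylow(G) P -> ~ generalized_quaternion P)
    (conn : connected (proper_enhanced_power_graph G)) :
  diam (proper_enhanced_power_graph G) = 3.
Proof.
have indG : has_independent_pairs G.
  move=> p ncp; have [pr_p _] := noncyclic_primesP ncp.
  apply: exists_independent_pair => //; apply: (no_quaternion_Sylow p) => //.
  exact: nilpotent_pcore_Hall.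
(* Otherwise every element has order prime to the noncyclic primes, so G is its
   own cyclic Hall subgroup. *)
have [p ncp]: exists p, p \in noncyclic_primes G.
  have [x Gx not_cyc]: exists2 x, x \in G & ~~ (noncyclic_primes G)^'.-elt x.
    apply/exists_inP; apply: contraR G_noncyclic; rewrite negb_exists_in.
    move/forall_inP=> all_cyc.
    have <-: 'O_(noncyclic_primes G)^'(G) = G.
      apply/pcore_pgroup_id/pgroupP=> q pr_q /(Cauchy pr_q)[z Gz oz].
      by have /negbNE/pgroupP := all_cyc z Gz; apply; rewrite // -orderE oz.
    exact: nilpotent_cyclic_Hall.
  move: not_cyc; rewrite /p_elt /pnat order_gt0 => /allPn[p _]; rewrite /= negbK.
  by exists p.
have [x [y [Gx Gy xy]]] := exists_far_vertices G_nilpotent indG.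
have Vx: x \in vertices (proper_enhanced_power_graph G).
  apply/proper_vertexP=> //; split=> //; exists p => //.
  by have [ab /and5P[_ _ /eqP<- _ _] [ax _]] := xy p ncp; rewrite order_dvdG.
have Vy: y \in vertices (proper_enhanced_power_graph G).
  apply/proper_vertexP=> //; split=> //; exists p => //.
  by have [ab /and5P[_ _ _ /eqP<- _] [_ by_]] := xy p ncp; rewrite order_dvdG.
apply: (@diam_eq _ _ 3 x y) => //; first by move=> u v; apply: proper_dist_le3.
apply: dist_gt2; first exact: conn.
move=> z; rewrite !proper_adj => xz zy.
have Vz: z \in vertices (proper_enhanced_power_graph G).
  by case/predU1P: xz => [<- // | /and4P[]].
(* At a noncyclic prime q dividing #[z], both members of the pair are powers of z. *)
have [Gz [q ncq q_z]] := proper_vertexP z G_nilpotent indG Vz.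
have join_xz: joined G x z.
  by case/predU1P: xz => [<- | /and4P[] //]; rewrite mem_cycle_joined ?cycle_id.
have join_yz: joined G y z.
  case/predU1P: zy => [-> | /and4P[_ _ _]]; last by rewrite joined_sym.
  by rewrite mem_cycle_joined ?cycle_id.
have [pr_q _] := noncyclic_primesP ncq; have [ab indab [ax by_]] := xy q ncq.
have := indab; rewrite inE => /and5P[_ _ /eqP oa /eqP ob _].
apply: (independent_pair_no_cycle pr_q indab Gz).
  by apply: joined_prime_order join_xz ax _ _; rewrite oa.
by apply: joined_prime_order join_yz by_ _ _; rewrite ob.
Qed.
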